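(* For all $x\in(-\tfrac12,\infty)$ and $k\in\{0,1,\dots\}$, $$\mathcal L_k(x)<\mathcal L_{k+1}(x)<\mathcal L_\infty(x)=W(x)=\mathcal U_\infty(x)<\mathcal U_{k+1}(x)<\mathcal U_k(x).$$ Moreover, the relative errors $\frac{\mathcal U_k(x)-W(x)}{W(x)}$ and $\frac{W(x)-\mathcal L_k(x)}{W(x)}$ of the bounds $\mathcal U_k(x)$ and $\mathcal L_k(x)$ converge to $0$ as $k\to\infty$ geometrically and uniformly on any interval of the form $[x_0,\infty)$, for any $x_0>-\frac12$; also, for each $k\in\{0,1,\dots\}$, these relative errors converge to $0$ as $x\to\infty$. Furthermore, for each $k\in\{0,1,\dots\}$, the absolute errors $\mathcal U_k(x)-W(x)$ and $W(x)-\mathcal L_k(x)$ converge to $0$, too, as $x\to\infty$.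
   Context: The Wallis ratio is $W(x):=\dfrac{\Gamma(x+1)}{\Gamma(x+\frac12)}$ for $x\in(-\frac12,\infty)$. For $p\in(0,\infty)$, integers $m\ge0$, and $k\in\{0,1,\dots,\infty\}$, $$\sigma_{p,m}:=\sum_{j=0}^m(-1)^j\binom mj\ln(p+j),\qquad U_k(p):=\exp\sum_{m=1}^k2^{-1-m}\sigma_{p,m},\qquad L_k(p):=\sqrt{\frac p{p+1}}\,\frac1{U_k(p+1)},$$ where the sum of an empty family is $0$ (so $U_0(p)=1$), and the infinite series for $k=\infty$ converges for every $p\in(0,\infty)$. For $x\in(-\frac12,\infty)$ and $k\in\{0,1,\dots,\infty\}$, with $p:=2x+1\in(0,\infty)$, $$\mathcal U_k(x):=U_k(p)\sqrt{p/2},\qquad \mathcal L_k(x):=L_k(p)\sqrt{p/2}.$$ Convergence of the relative errors to $0$ ''geometrically and uniformly on $[x_0,\infty)$'' means convergence no slower than geometric: there are constants $C\in(0,\infty)$ and $q\in(0,1)$, possibly depending on $x_0$, such that both relative errors are at most $Cq^k$ for all $x\ge x_0$ and all $k\in\{0,1,\dots\}$. *)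

(* Defs.v *)
From mathcomp Require Import all_boot all_order all_algebra.
From mathcomp Require Import all_classical all_reals all_analysis.
Set Implicit Arguments.
Unset Strict Implicit.
Unset Printing Implicit Defensive.
Import Order.TTheory GRing.Theory Num.Theory.
Import numFieldNormedType.Exports.
Local Open Scope classical_set_scope.
Local Open Scope ring_scope.

(* Euler's integral of the second kind; it represents the Gamma function for
   x > 0, the only arguments needed below. *)
Definition Gamma (R : realType) (x : R) : R :=
  \int[lebesgue_measure]_(t in `]0, +oo[) (t `^ (x - 1) * expR (- t)).

(* Meaningful for - 2^-1 < x. *)
Definition wallis (R : realType) (x : R) : R :=
  Gamma (x + 1) / Gamma (x + 2^-1).

Definition sigma (R : realType) (p : R) (m : nat) : R :=
  \sum_(0 <= j < m.+1) (-1) ^+ j * 'C(m, j)%:R * ln (p + j%:R).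

(* An index k in {0, 1, ..., oo} is an option nat, None standing for oo. *)
Definition Ubd (R : realType) (k : option nat) (p : R) : R :=
  expR (if k is Some n
        then \sum_(1 <= m < n.+1) 2 ^- (1 + m) * sigma p m
        else limn (fun n => \sum_(1 <= m < n.+1) 2 ^- (1 + m) * sigma p m)).

Definition Lbd (R : realType) (k : option nat) (p : R) : R :=
  Num.sqrt (p / (p + 1)) * (1 / Ubd k (p + 1)).

Definition calU (R : realType) (k : option nat) (x : R) : R :=
  let p := 2 * x + 1 in Ubd k p * Num.sqrt (p / 2).

Definition calL (R : realType) (k : option nat) (x : R) : R :=
  let p := 2 * x + 1 in Lbd k p * Num.sqrt (p / 2).

(* Main.v *)
Require Import Defs.
From mathcomp Require Import all_boot all_order all_algebra.
From mathcomp Require Import all_classical all_reals all_analysis measurable_realfun.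
From mathcomp Require Import ring lra.
Import Order.TTheory GRing.Theory Num.Theory.
Import numFieldNormedType.Exports.
Local Open Scope classical_set_scope.
Local Open Scope ring_scope.

(** Put p = 2x + 1, so that W(x) is the ratio
    w(p) = Gamma((p + 1)/2) / Gamma(p/2), and let S(p) be the sum of the
    infinite series of the terms 2^(-1-m) sigma_{p,m}.  Everything reduces to
    the identity ln (w(p) / sqrt(p/2)) = S(p) and to the size of the tails of
    the series.

    Both sides of the identity satisfy the same first-order functional
    equation g(p) + g(p + 1) = (ln p - ln(p + 1))/2.  For the left side
    ([log_ratioD]) this is the recurrence Gamma(y + 1) = y Gamma(y), because
    w(p) w(p + 1) telescopes to p/2.  For the series ([psum_limD]) it is the
    difference relation sigma_{p,m+1} = sigma_{p,m} - sigma_{p+1,m}, which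
    makes the sum telescope as well.  Hence the difference D of the two sides
    satisfies D(p + 1) = -D(p), and |D| has period 1.  Since both sides are
    O(1/p), D vanishes ([log_ratio_psum_lim]).  The bound on the left side comes
    from Gamma(y + 1/2) <= sqrt(y) Gamma(y), that is, from the arithmetic-
    geometric mean inequality under Euler's integral.

    The tails are controlled by the sign and the monotonicity of sigma.  The
    derivative of sigma_{p,m} in p is m! / (p (p+1) ... (p+m)) > 0, so by the
    difference relation sigma_{p,m+1} < 0 and, from m = 1 on, the sequence
    increases with m; thus -1/p <= sigma_{p,m} < 0 for m >= 1.  The partial
    sums therefore decrease strictly to S(p), and the k-th one exceeds S(p) by
    some err_k(p) in the interval ]0, 2^(-k-1)/p] ([psum_err_gt0],
    [psum_err_le]).

    Finally U_k = W exp(err_k(p)), and the functional equation of S gives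
    L_k = W exp(-err_k(p + 1)) ([calU_fin], [calL_fin]).  The chain of
    inequalities is the strict decrease of err_k.  The relative errors are at
    most exp(1/p)/p 2^(-k), which gives the geometric convergence and the limit
    at infinity; multiplied by W <= sqrt p they still tend to 0. *)

(** * Euler's integral *)

Definition gamma_kernel {R : realType} (x t : R) : R :=
  t `^ (x - 1) * expR (- t).

(** Kept in the extended reals, so that the recurrence can be proved before
    finiteness and then used to prove it. *)
Definition gamma_integral {R : realType} (x : R) : \bar R :=
  (\int[lebesgue_measure]_(t in `]0%R, +oo[) (gamma_kernel x t)%:E)%E.

Lemma gamma_kernel_ge0 {R : realType} (x t : R) : 0 <= gamma_kernel x t.
Proof. by rewrite mulr_ge0 ?powR_ge0 ?expR_ge0. Qed.

Lemma measurable_gamma_kernel {R : realType} (x : R) (D : set R) :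
  measurable_fun D (gamma_kernel x).
Proof.
apply: measurable_funTS; apply: measurable_funM.
  exact: measurable_powR.
by apply: measurableT_comp => //; exact: measurable_funN.
Qed.

(** After taking logarithms this is ln u <= u at u = t/(2x). *)
Lemma gamma_kernel_exp_bound {R : realType} (x t : R) : 0 < x -> 0 < t ->
  gamma_kernel (x + 1) t <= (2 * x) `^ x * expR (- (t / 2)).
Proof.
move=> x0 t0; have x20 : 0 < 2 * x by rewrite mulr_gt0.
rewrite /gamma_kernel addrK /powR !gt_eqF// -!expRD ler_expR.
have /ltW := ln_sublinear (divr_gt0 t0 x20).
rewrite ln_div ?posrE// => /(ler_wpM2l (ltW x0)).
rewrite (_ : x * (t / (2 * x)) = t / 2); first lra.
by field; rewrite gt_eqF.
Qed.

(** Compact intervals away from 0, where the kernel may be singular; the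
    shift by 2 keeps the endpoints distinct. *)
Definition exhaustion {R : realType} (n : nat) : set R :=
  `[n.+2%:R^-1, n.+2%:R]%classic.

Lemma bigcup_exhaustion {R : realType} :
  \bigcup_n exhaustion n = `]0%R, +oo[%classic :> set R.
Proof.
apply/seteqP; split => [t [n _]|t]; rewrite /exhaustion/= !in_itv/= ?andbT.
  by move=> /andP[+ _]; apply: lt_le_trans; rewrite invr_gt0.
move=> t0; exists (maxn (Num.truncn t) (Num.truncn t^-1)) => //=.
rewrite in_itv/=; apply/andP; split; last first.
  apply: (le_trans (ltW (truncnS_gt _))); rewrite ler_nat.
  by rewrite ltnS leqW// leq_maxl.
rewrite -[leRHS]invrK lef_pV2 ?posrE ?invr_gt0//.
apply: (le_trans (ltW (truncnS_gt _))); rewrite ler_nat.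
by rewrite ltnS leqW// leq_maxr.
Qed.

Lemma exhaustion_cvg {R : realType} (x : R) :
  (\int[lebesgue_measure]_(t in exhaustion n) (gamma_kernel x t)%:E)%E @[n --> \oo]
    --> gamma_integral x.
Proof.
rewrite /gamma_integral -bigcup_exhaustion.
apply: ge0_nondecreasing_set_cvg_integral => //.
- apply/nondecreasing_seqP => n; apply/subsetPset => t; rewrite /exhaustion/= !in_itv/=.
  move=> /andP[a b]; apply/andP; split.
    by apply: le_trans a; rewrite lef_pV2 ?posrE// ler_nat.
  by apply: (le_trans b); rewrite ler_nat.
- by move=> n; exact: measurable_itv.
- by move=> n; apply/measurable_EFinP; exact: measurable_gamma_kernel.
- by move=> n t _; rewrite lee_fin gamma_kernel_ge0.
Qed.

Lemma gamma_by_parts {R : realType} (x a b : R) :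
  0 < x -> 0 < a -> a < b ->
  (\int[lebesgue_measure]_(t in `[a, b]) (gamma_kernel (x + 1) t)%:E =
   (gamma_kernel (x + 1) a - gamma_kernel (x + 1) b)%:E +
   x%:E * \int[lebesgue_measure]_(t in `[a, b]) (gamma_kernel x t)%:E)%E.
Proof.
move=> x0 a0 ab.
have contE (t : R) : (expR (- s) : R) @[s --> t] --> expR (- t).
  by apply: continuous_comp; [exact: opp_continuous|exact: continuous_expR].
have contP (y t : R) : 0 < t -> (s `^ y) @[s --> t] --> t `^ y.
  move=> t0.
  have [/derivable1_diffP/differentiable_continuous + _] := is_derive1_powR y t0.
  exact.
have dE (t : R) : is_derive t 1 (fun s : R => - expR (- s)) (expR (- t)).
  apply: is_derive_eq;  by rewrite /GRing.scale/=; ring.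
have b0 := lt_trans a0 ab.

have inab (t : R) : t \in `[a, b] -> 0 < t.
  by rewrite in_itv/= => /andP[+ _]; exact: lt_le_trans.
have inaboo (t : R) : t \in `]a, b[ -> 0 < t.
  by rewrite in_itv/= => /andP[+ _]; exact: lt_trans.
rewrite [X in (X = _)%E](_ : _ =
  \int[lebesgue_measure]_(t in `[a, b]) (t `^ x * expR (- t))%:E)%E; last first.
  by apply: eq_integral => t _; rewrite /gamma_kernel addrK.
rewrite (@integration_by_parts R (fun t => t `^ x) (fun t => - expR (- t))
  (fun t => x * t `^ (x - 1)) (fun t => expR (- t)) a b ab).
- rewrite /gamma_kernel addrK.
  rewrite (_ : _ * - _ - _ = a `^ x * expR (- a) - b `^ x * expR (- b)); last by ring.
  congr (_ + _)%E; rewrite -ge0_integralZl//=; last 3 first.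
  + by apply/measurable_EFinP; exact: measurable_gamma_kernel.
  + by move=> t _; rewrite lee_fin gamma_kernel_ge0.
  + by rewrite lee_fin ltW.
  rewrite [X in (- X)%E](_ : _ = \int[lebesgue_measure]_(t in `[a, b])
      - (x%:E * (gamma_kernel x t)%:E))%E; last first.
    apply: eq_integral => t _; rewrite -EFinM -EFinN; congr EFin.
    by rewrite /gamma_kernel; ring.
  rewrite integral_ge0N ?oppeK// => t _.
  by rewrite -EFinM lee_fin mulr_ge0 ?gamma_kernel_ge0// ltW.
- apply/subspace_continuousP => t /inab t0.
  by apply: cvg_within_filter; apply: cvgM; [exact: cvg_cst|exact: contP].
- split.
  + by move=> t /inaboo t0; have [] := is_derive1_powR x t0.
  + by apply: cvg_at_right_filter; exact: contP.
  + by apply: cvg_at_left_filter; exact: contP.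
- by move=> t /inaboo t0; rewrite powR_derive1// in_itv/= t0.
- apply/subspace_continuousP => t _.
  by apply: cvg_within_filter; exact: contE.
- split.
  + by move=> t _; have [] := dE t.
  + by apply: cvg_at_right_filter; apply: cvgN; exact: contE.
  + by apply: cvg_at_left_filter; apply: cvgN; exact: contE.
- by move=> t _; rewrite derive1E; have [_ ->] := dE t.
Qed.

Lemma gamma_kernel_cvg_pinfty {R : realType} (x : R) : 0 < x ->
  gamma_kernel (x + 1) n.+2%:R @[n --> \oo] --> (0 : R).
Proof.
move=> x0; set q : R := expR (- 2^-1).
apply: (@squeeze_cvgr _ _ _ _ (fun=> 0) (fun n => (2 * x) `^ x * q ^+ 2 * q ^+ n)).
- near=> n; rewrite gamma_kernel_ge0/= -mulrA -exprD -expRM_natr mulNr [2^-1 * _]mulrC.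
  exact: gamma_kernel_exp_bound.
- exact: cvg_cst.
- suff: (2 * x) `^ x * q ^+ 2 * q ^+ n @[n --> \oo] --> (2 * x) `^ x * q ^+ 2 * 0.
    by rewrite mulr0.
  apply: cvgM; first exact: cvg_cst.
  by apply: cvg_expr; rewrite ger0_norm ?expR_ge0// expR_lt1 oppr_lt0.
Unshelve. all: by end_near. Qed.

Lemma gamma_kernel_cvg_0 {R : realType} (x : R) : 0 < x ->
  gamma_kernel (x + 1) n.+2%:R^-1 @[n --> \oo] --> (0 : R).
Proof.
move=> x0.
apply: (@squeeze_cvgr _ _ _ _ (fun=> 0) (fun n => n.+2%:R^-1 `^ x)).
- near=> n; rewrite gamma_kernel_ge0/= /gamma_kernel addrK.
  by rewrite ler_piMr ?powR_ge0// expR_le1 oppr_le0.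
- exact: cvg_cst.
- have /cvg_at_rightP := powR_cvg0 x0; apply; split=> [n|]; first by rewrite invr_gt0.
  have := @cvg_harmonic R; rewrite -cvg_shiftS; exact.
Unshelve. all: by end_near. Qed.

(** The boundary terms of the integration by parts over the exhaustion vanish
    in the limit.  No finiteness is assumed: both sides may a priori be
    infinite. *)
Lemma gamma_integralS {R : realType} (x : R) : 0 < x ->
  gamma_integral (x + 1) = (x%:E * gamma_integral x)%E.
Proof.
move=> x0.
pose r n : R := gamma_kernel (x + 1) n.+2%:R^-1 - gamma_kernel (x + 1) n.+2%:R.
pose I n : \bar R := (\int[lebesgue_measure]_(t in exhaustion n) (gamma_kernel x t)%:E)%E.
have h1 := @exhaustion_cvg R (x + 1).
have h2 : I n @[n --> \oo] --> gamma_integral x by exact: exhaustion_cvg.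
have r0 : r n @[n --> \oo] --> (0 : R).
  suff: r n @[n --> \oo] --> (0 - 0 : R) by rewrite subr0.
  by apply: cvgB; [exact: gamma_kernel_cvg_0|exact: gamma_kernel_cvg_pinfty].
suff h3 : ((r n)%:E + x%:E * I n)%E @[n --> \oo] --> (x%:E * gamma_integral x)%E.
  apply: (cvg_unique _ h1) => //; apply: cvg_trans h3; apply: near_eq_cvg; near=> n.
  rewrite [RHS]gamma_by_parts//.
  by apply: (@lt_trans _ _ 1); rewrite ?invf_lt1 ?ltr1n.
rewrite -[(x%:E * gamma_integral x)%E]add0e; apply: cvgeD => //; last exact: cvgeZl.
by apply: cvg_EFin => //; near=> n.
Unshelve. all: by end_near. Qed.

(** By the recurrence it suffices that the integral at x + 1 is finite, where
    the kernel has no singularity at 0 and is dominated by an exponential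
    density; the singular range 0 < x < 1 needs no estimate of its own. *)
Lemma gamma_integral_fin {R : realType} (x : R) : 0 < x ->
  gamma_integral x \is a fin_num.
Proof.
move=> x0.
have I0 : (0%R <= gamma_integral x)%E.
  by apply: integral_ge0 => t _; rewrite lee_fin gamma_kernel_ge0.
rewrite ge0_fin_numE//; move: (gamma_integralS x x0).
case: (gamma_integral x) I0 => //= [s _|]; first by rewrite ltry.
rewrite gt0_muley ?lte_fin// => _ h; exfalso.
pose C : R := (2 * x) `^ x * 2.
pose e : R -> R := exponential_pdf 2^-1.
have C0 : 0 <= C by rewrite mulr_ge0// powR_ge0.
suff : (gamma_integral (x + 1) <= C%:E)%E by rewrite h.
have <- : (\int[lebesgue_measure]_t (C%:E * (e t)%:E) = C%:E)%E.
  rewrite ge0_integralZl//=.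
  - by rewrite integral_exponential_pdf ?mule1.
  - by apply/measurable_EFinP; exact: measurable_exponential_pdf.
  - by move=> t _; rewrite lee_fin exponential_pdf_ge0.
rewrite /gamma_integral integral_mkcond; apply: ge0_le_integral => //=.
- by move=> t _; apply: erestrict_ge0 => {}t _; rewrite lee_fin gamma_kernel_ge0.
- apply/(measurable_restrictT (fun t => (gamma_kernel (x + 1) t)%:E)) => //.
  by apply/measurable_EFinP; exact: measurable_gamma_kernel.
- apply/measurable_EFinP; apply: measurable_funM => //.
  exact: measurable_exponential_pdf.
- move=> t _; rewrite patchE; case: ifPn => [|_]; last first.
    by rewrite -EFinM lee_fin mulr_ge0// exponential_pdf_ge0.
  rewrite inE/= in_itv/= andbT => t0.
  rewrite -EFinM lee_fin /e exponential_pdfE; last exact: ltW.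
  apply: le_trans (gamma_kernel_exp_bound _ _ x0 t0) _.
  by rewrite /C mulrA mulfK// mulNr [t / 2]mulrC.
Qed.

Lemma Gamma_fine {R : realType} (x : R) : 0 < x -> (Gamma x)%:E = gamma_integral x.
Proof. by move=> x0; rewrite -[RHS]fineK// gamma_integral_fin. Qed.

Lemma Gamma_recurrence {R : realType} (x : R) : 0 < x -> Gamma (x + 1) = x * Gamma x.
Proof.
move=> x0; apply: EFin_inj; rewrite EFinM !Gamma_fine ?addr_gt0//.
exact: gamma_integralS.
Qed.

(** Integrate the kernel at x against the arithmetic-geometric mean inequality
    sqrt t <= (t / sqrt x + sqrt x) / 2 and apply the recurrence to the first
    term. *)
Lemma Gamma_half_le {R : realType} (x : R) : 0 < x ->
  Gamma (x + 2^-1) <= Num.sqrt x * Gamma x.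
Proof.
move=> x0; set s := Num.sqrt x.
have s0 : 0 < s by rewrite sqrtr_gt0.
have ss : s ^+ 2 = x by rewrite sqr_sqrtr ?ltW.
suff : (gamma_integral (x + 2^-1) <= (s^-1 / 2)%:E * gamma_integral (x + 1) +
          (s / 2)%:E * gamma_integral x)%E.
  rewrite -!Gamma_fine ?addr_gt0// -!EFinM -EFinD lee_fin Gamma_recurrence//.
  move=> /le_trans; apply.
  rewrite -ss le_eqVlt; apply/orP; left; apply/eqP; field.
  by rewrite gt_eqF.
have mk (y : R) (D : set R) : measurable_fun D (EFin \o gamma_kernel y).
  by apply/measurable_EFinP; exact: measurable_gamma_kernel.
have k0 (y t : R) : (0 <= (gamma_kernel y t)%:E)%E.
  by rewrite lee_fin gamma_kernel_ge0.
have c1 : 0 <= s^-1 / 2 by rewrite divr_ge0// invr_ge0 ltW.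
have c2 : 0 <= s / 2 by rewrite divr_ge0// ltW.
rewrite -!ge0_integralZl//=; try exact: mk.
rewrite -ge0_integralD//=; last 4 first.
- by move=> t _; rewrite mule_ge0// lee_fin.
- by apply: measurable_funeM; exact: mk.
- by move=> t _; rewrite mule_ge0// lee_fin.
- by apply: measurable_funeM; exact: mk.
apply: ge0_le_integral => //=; try exact: mk.
- by apply: emeasurable_funD; apply: measurable_funeM; exact: mk.
move=> t; rewrite in_itv/= andbT => t0.
rewrite -!EFinM -EFinD lee_fin /gamma_kernel addrK.
set u := Num.sqrt t.
have uu : u ^+ 2 = t by rewrite sqr_sqrtr ?ltW.
have -> : t `^ (x + 2^-1 - 1) = t `^ (x - 1) * u.
  rewrite addrAC [LHS]powRD ?powR12_sqrt ?(ltW t0)//.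
  by rewrite (gt_eqF t0) implybT.
have -> : t `^ x = t `^ (x - 1) * u ^+ 2.
  by rewrite uu mulrC mulr_powRB1// ltW.
(* the difference of the two sides is a square times a positive weight *)
have : 0 <= t `^ (x - 1) * expR (- t) * ((u - s) ^+ 2 / (2 * s)).
  apply: mulr_ge0; first by rewrite mulr_ge0 ?powR_ge0 ?expR_ge0.
  by rewrite divr_ge0 ?sqr_ge0// mulr_ge0// ltW.
rewrite -subr_ge0; congr (_ <= _); field.
by rewrite gt_eqF.
Qed.

(** The recurrence moves the argument above 1, where the kernel is at least
    exp(-2) on [1, 2]. *)
Lemma Gamma_gt0 {R : realType} (x : R) : 0 < x -> 0 < Gamma x.
Proof.
move=> x0.
suff : 0 < Gamma (x + 1) by rewrite Gamma_recurrence// pmulr_rgt0.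
rewrite -lte_fin Gamma_fine ?addr_gt0//.
apply: (@lt_le_trans _ _ (expR (- 2))%:E); first by rewrite lte_fin expR_gt0.
have -> : ((expR (- 2))%:E =
    \int[lebesgue_measure]_(t in `[1%R, 2%R]) (cst (expR (- 2) : R)%:E t))%E.
  rewrite integral_cst//= lebesgue_measure_itv/= lte_fin ltr1n -EFinB -EFinM.
  congr EFin; ring.
have mk (D : set R) : measurable_fun D (EFin \o gamma_kernel (x + 1)).
  by apply/measurable_EFinP; exact: measurable_gamma_kernel.
apply: (@le_trans _ _ (\int[lebesgue_measure]_(t in `[1%R, 2%R])
                         (gamma_kernel (x + 1) t)%:E)%E).
  apply: ge0_le_integral => //=.
  + exact: mk.
  move=> t; rewrite in_itv/= => /andP[t1 t2].
  rewrite lee_fin /gamma_kernel addrK.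
  apply: (@le_trans _ _ (1 * expR (- t))).
    by rewrite mul1r ler_expR lerN2.
  by rewrite ler_wpM2r ?expR_ge0// -(powRr0 t) ler_powR// ltW.
apply: ge0_subset_integral => //=.
- exact: mk.
- by move=> t _; rewrite /= lee_fin gamma_kernel_ge0.
- by move=> t /=; rewrite !in_itv/= andbT => /andP[t1 _]; exact: lt_le_trans t1.
Qed.

(** * Alternating binomial sums of logarithms *)

Lemma sigma0 {R : realType} (p : R) : sigma p 0 = ln p.
Proof. by rewrite /sigma big_nat1 expr0 bin0 !mul1r addr0. Qed.

(** Pascal's rule: up to sign, sigma is an iterated finite difference of the
    logarithm. *)
Lemma sigmaS {R : realType} (p : R) (m : nat) :
  sigma p m.+1 = sigma p m - sigma (p + 1) m.
Proof.
rewrite /sigma; pose l j : R := ln (p + j%:R).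
rewrite (eq_big_nat _ _ (F2 := fun j => (-1) ^+ j * 'C(m.+1, j)%:R * l j))//.
rewrite [X in _ = X - _](_ : _ =
  \sum_(0 <= j < m.+2) (-1) ^+ j * 'C(m, j)%:R * l j); last first.
  by rewrite [RHS]big_nat_recr//= bin_small// mulr0 mul0r addr0.
rewrite [in LHS]big_nat_recl// [in RHS]big_nat_recl//= !bin0 -addrA; congr (_ + _).
rewrite -sumrB; apply: eq_bigr => j _.
rewrite (_ : p + 1 + j%:R = p + j.+1%:R); last by rewrite -addrA -natr1 [1 + _]addrC.
by rewrite -/(l j.+1) binS natrD exprS; ring.
Qed.

(** The derivative of sigma in p, in closed form, so that its sign is visible. *)
Definition dsigma {R : realType} (p : R) (m : nat) : R :=
  m`!%:R / \prod_(0 <= j < m.+1) (p + j%:R).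

Lemma dsigma_gt0 {R : realType} (p : R) (m : nat) : 0 < p -> 0 < dsigma p m.
Proof.
move=> p0; rewrite divr_gt0 ?ltr0n ?fact_gt0//.
by rewrite prodr_gt0// => j _; rewrite ltr_wpDr.
Qed.

(** The factors common to both denominators leave (p + m + 1) - p = m + 1 in
    the numerator, which turns m! into (m + 1)!. *)
Lemma dsigmaS {R : realType} (p : R) (m : nat) : 0 < p ->
  dsigma p m.+1 = dsigma p m - dsigma (p + 1) m.
Proof.
move=> p0; rewrite /dsigma.
pose Q := \prod_(0 <= j < m) (p + j.+1%:R).
have Q0 : 0 < Q by rewrite prodr_gt0// => j _; rewrite addr_gt0.
have sh j : p + 1 + j%:R = p + j.+1%:R by rewrite -addrA -natr1 [1 + _]addrC.
have -> : \prod_(0 <= j < m.+2) (p + j%:R) = p * Q * (p + m.+1%:R).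
  by rewrite big_nat_recr//= big_nat_recl//= addr0.
have -> : \prod_(0 <= j < m.+1) (p + j%:R) = p * Q by rewrite big_nat_recl//= addr0.
have -> : \prod_(0 <= j < m.+1) (p + 1 + j%:R) = Q * (p + m.+1%:R).
  by rewrite big_nat_recr//= sh; congr (_ * _); apply: eq_bigr => j _; rewrite sh.
rewrite factS natrM.
have ? : 0 < p + m.+1%:R by rewrite addr_gt0.
by field; rewrite [1 + _]addrC natr1 !gt_eqF.
Qed.

Lemma is_derive_sigma {R : realType} (m : nat) (p : R) : 0 < p ->
  is_derive p 1 (fun q => sigma q m) (dsigma p m).
Proof.
elim: m p => [|m IH] p p0.
  rewrite (_ : (fun q => _) = @ln R); last by apply/funext => q; rewrite sigma0.
  by rewrite /dsigma big_nat1 addr0 fact0 div1r; exact: is_derive1_ln.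
rewrite (_ : (fun q => _) = (fun q => sigma q m) \-
  ((fun q => sigma q m) \o (fun q => q + 1))); last first.
  by apply/funext => q; rewrite sigmaS.
rewrite dsigmaS//.
have h1 := IH p p0.
have h2 := IH (p + 1) (addr_gt0 p0 ltr01).
apply: is_deriveB; rewrite -[dsigma (p + 1) m]mulr1.
apply: (@is_derive1_comp R _ (fun q => q + 1) p _ 1).
rewrite -[X in is_derive _ _ _ X]addr0; exact: is_deriveD.
Qed.

Lemma sigma_lt {R : realType} (p : R) (m : nat) : 0 < p -> sigma p m < sigma (p + 1) m.
Proof.
move=> p0; have pp : p < p + 1 by rewrite ltrDl.
apply: (@gtr0_derive1_incr R (fun q => sigma q m) p (p + 1)) => //.
- move=> q; rewrite in_itv/= => /andP[pq _].
  by have [] := is_derive_sigma m q (lt_trans p0 pq).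
- move=> q; rewrite in_itv/= => /andP[pq _].
  have [_ h] := is_derive_sigma m q (lt_trans p0 pq).
  by rewrite derive1E h dsigma_gt0// (lt_trans p0).
- apply/subspace_continuousP => q /=; rewrite in_itv/= => /andP[pq _].
  have [/derivable1_diffP/differentiable_continuous + _] :=
    is_derive_sigma m q (lt_le_trans p0 pq).
  by move=> h; apply: cvg_within_filter; exact: h.
Qed.

Lemma sigma_lt0 {R : realType} (p : R) (m : nat) : 0 < p -> sigma p m.+1 < 0.
Proof. by move=> p0; rewrite sigmaS subr_lt0 sigma_lt. Qed.

(** Induction on m: sigma increases with m from m = 1 on, because the
    subtracted sigma at p + 1 is negative; the base case is
    ln(1 + 1/p) <= 1/p. *)
Lemma sigma_ge {R : realType} (p : R) (m : nat) : 0 < p -> - p^-1 <= sigma p m.+1.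
Proof.
move=> p0; elim: m => [|m IH].
  rewrite sigmaS !sigma0 -opprB lerN2.
  have p1 : 0 < p + 1 by rewrite addr_gt0.
  rewrite -ln_div ?posrE// mulrDl divff ?gt_eqF// div1r le_ln1Dx//.
  by rewrite (@lt_trans _ _ 0)// ?oppr_lt0// invr_gt0.
rewrite sigmaS (le_trans IH)// lerDl oppr_ge0 ltW// sigma_lt0// addr_gt0//.
Qed.

(** * The series defining the bounds *)

Definition psum {R : realType} (p : R) (n : nat) : R :=
  \sum_(1 <= m < n.+1) 2 ^- (1 + m) * sigma p m.

Definition psum_lim {R : realType} (p : R) : R := limn (psum p).

Lemma psum0 {R : realType} (p : R) : psum p 0 = 0.
Proof. by rewrite /psum big_geq. Qed.

Lemma psumS {R : realType} (p : R) (n : nat) :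
  psum p n.+1 = psum p n + 2 ^- n.+2 * sigma p n.+1.
Proof. by rewrite /psum big_nat_recr. Qed.

Lemma psumS_lt {R : realType} (p : R) (n : nat) : 0 < p -> psum p n.+1 < psum p n.
Proof.
by move=> p0; rewrite psumS gtrDl pmulr_rlt0 ?sigma_lt0// invr_gt0 exprn_gt0.
Qed.

Lemma psum_nonincreasing {R : realType} (p : R) : 0 < p ->
  {homo psum p : n m / (n <= m)%N >-> m <= n}.
Proof.
by move=> p0; apply/nonincreasing_seqP => n; rewrite ltW// psumS_lt.
Qed.

(** The quantity psum p k - 2^(-k-1)/p increases with k, since sigma >= -1/p and
    the weights sum to a geometric tail.  This bounds the partial sums from
    below and estimates the remainders at once. *)
Lemma psum_tail {R : realType} (p : R) (k n : nat) : 0 < p ->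
  psum p k - 2 ^- k.+1 / p <= psum p (k + n) - 2 ^- (k + n).+1 / p.
Proof.
move=> p0; elim: n => [|n IH]; first by rewrite addn0.
apply: le_trans IH _; rewrite addnS psumS; set j := (k + n)%N.
have := sigma_ge p j p0.
have h0 : 0 < 2 ^- j.+2 :> R by rewrite invr_gt0 exprn_gt0.
move=> /(ler_wpM2l (ltW h0)).
have -> : 2 ^- j.+1 = 2 * 2 ^- j.+2 :> R.
  by rewrite [in RHS]exprS invfM mulVKf.
lra.
Qed.

Lemma psum_cvg {R : realType} (p : R) : 0 < p -> psum p n @[n --> \oo] --> psum_lim p.
Proof.
move=> p0; apply: nonincreasing_is_cvgn; first exact: psum_nonincreasing.
exists (psum p 0 - 2 ^- 1 / p) => _ [n _ <-].
apply: le_trans (psum_tail p 0 n p0) _.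
by rewrite add0n gerBl divr_ge0 ?invr_ge0 ?exprn_ge0// ltW.
Qed.

Lemma psum_lim_lt {R : realType} (p : R) (k : nat) : 0 < p -> psum_lim p < psum p k.
Proof.
move=> p0; apply: le_lt_trans (psumS_lt p k p0).
apply: nonincreasing_cvgn_ge; first exact: psum_nonincreasing.
by apply/cvg_ex; exists (psum_lim p); exact: psum_cvg.
Qed.

Lemma psum_lim_ge {R : realType} (p : R) (k : nat) : 0 < p ->
  psum p k - 2 ^- k.+1 / p <= psum_lim p.
Proof.
move=> p0; apply: limr_ge.
  by apply/cvg_ex; exists (psum_lim p); exact: psum_cvg.
near=> n; have kn : (k <= n)%N by near: n; exact: nbhs_infty_ge.
rewrite -(subnKC kn); apply: le_trans (psum_tail p k (n - k) p0) _.
by rewrite gerBl divr_ge0 ?invr_ge0 ?exprn_ge0// ltW.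
Unshelve. all: by end_near. Qed.

(** Adding the two series term by term and using [sigmaS], consecutive terms
    cancel in pairs; the n-th partial sum is sigma_{p,1}/2 up to a term of
    order 2^(-n). *)
Lemma psum_limD {R : realType} (p : R) : 0 < p ->
  psum_lim p + psum_lim (p + 1) = (ln p - ln (p + 1)) / 2.
Proof.
move=> p0; have p1 : 0 < p + 1 by rewrite addr_gt0.
have E n : psum p n + psum (p + 1) n = sigma p 1 / 2 - 2 ^- n.+1 * sigma p n.+1.
  elim: n => [|n IH]; first by rewrite !psum0 expr1; ring.
  rewrite !psumS addrACA IH [sigma p n.+2]sigmaS.
  have -> : 2 ^- n.+1 = 2 * 2 ^- n.+2 :> R by rewrite [in RHS]exprS invfM mulVKf.
  ring.
have h1 : psum p n + psum (p + 1) n @[n --> \oo] --> psum_lim p + psum_lim (p + 1).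
  by apply: cvgD; exact: psum_cvg.
rewrite -!sigma0 -sigmaS; apply: (cvg_unique _ h1) => //.
apply: (@squeeze_cvgr _ _ _ _ (fun=> sigma p 1 / 2)
   (fun n => sigma p 1 / 2 + 2^-1 / p * 2^-1 ^+ n)).
- near=> n; rewrite E lerDl lerD2l oppr_ge0.
  have h0 : 0 < 2 ^- n.+1 :> R by rewrite invr_gt0 exprn_gt0.
  rewrite pmulr_rle0// ltW ?sigma_lt0//=.
  have /(ler_wpM2l (ltW h0)) := sigma_ge p n p0.
  rewrite exprVn [2 ^+ n.+1]exprS invfM; lra.
- exact: cvg_cst.
- suff: sigma p 1 / 2 + 2^-1 / p * 2^-1 ^+ n @[n --> \oo] -->
        sigma p 1 / 2 + 2^-1 / p * 0.
    by rewrite mulr0 addr0.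
  apply: cvgD; first exact: cvg_cst.
  apply: cvgM; first exact: cvg_cst.
  by apply: cvg_expr; rewrite ger0_norm ?invr_ge0// invf_lt1// ltr1n.
Unshelve. all: by end_near. Qed.

(** * Identification of the sum of the series *)

(** The Wallis ratio in the variable p = 2x + 1, in which its functional equation
    relates p and p + 1. *)
Definition gamma_ratio {R : realType} (p : R) : R := Gamma ((p + 1) / 2) / Gamma (p / 2).

Lemma gamma_ratio_gt0 {R : realType} (p : R) : 0 < p -> 0 < gamma_ratio p.
Proof. by move=> p0; rewrite divr_gt0// Gamma_gt0// divr_gt0// addr_gt0. Qed.

Lemma gamma_ratioM {R : realType} (p : R) : 0 < p -> gamma_ratio p * gamma_ratio (p + 1) = p / 2.
Proof.
move=> p0; rewrite /gamma_ratio (_ : (p + 1 + 1) / 2 = p / 2 + 1); last by field.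
rewrite Gamma_recurrence ?divr_gt0//.
have g1 : 0 < Gamma ((p + 1) / 2) by rewrite Gamma_gt0// divr_gt0// addr_gt0.
have g2 : 0 < Gamma (p / 2) by rewrite Gamma_gt0// divr_gt0.
by field; rewrite !gt_eqF.
Qed.

Lemma sqrt_expR {R : realType} (y : R) : 0 < y -> Num.sqrt y = expR (ln y / 2).
Proof. by move=> y0; rewrite -powR12_sqrt ?ltW// /powR gt_eqF// mulrC. Qed.

Definition log_ratio {R : realType} (p : R) : R := ln (gamma_ratio p) - ln (p / 2) / 2.

Lemma log_ratio_le0 {R : realType} (p : R) : 0 < p -> log_ratio p <= 0.
Proof.
move=> p0; have p2 : 0 < p / 2 by rewrite divr_gt0.
rewrite /log_ratio subr_le0 -ler_expR lnK ?posrE ?gamma_ratio_gt0// -sqrt_expR//.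
rewrite /gamma_ratio ler_pdivrMr ?Gamma_gt0//.
by rewrite (_ : (p + 1) / 2 = p / 2 + 2^-1) ?Gamma_half_le//; field.
Qed.

Lemma log_ratioD {R : realType} (p : R) : 0 < p ->
  log_ratio p + log_ratio (p + 1) = (ln p - ln (p + 1)) / 2.
Proof.
move=> p0; have p1 : 0 < p + 1 by rewrite addr_gt0.
rewrite /log_ratio addrACA -lnM ?posrE ?gamma_ratio_gt0// gamma_ratioM// !ln_div ?posrE//.
by field.
Qed.

(** The upper bound [log_ratio_le0] at p + 1 becomes a lower bound at p through
    the functional equation. *)
Lemma log_ratio_ge {R : realType} (p : R) : 0 < p -> - (p^-1 / 2) <= log_ratio p.
Proof.
move=> p0; have := log_ratioD p p0; rewrite -!sigma0 -sigmaS.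
have := log_ratio_le0 (p + 1) (addr_gt0 p0 ltr01).
have := sigma_ge p 0 p0; lra.
Qed.

(** The difference D of the two sides satisfies D(p + 1) = -D(p), so |D(p)|
    equals |D(p + n)| <= 1/(p + n) for every n. *)
Lemma log_ratio_psum_lim {R : realType} (p : R) : 0 < p -> log_ratio p = psum_lim p.
Proof.
move=> p0; pose D q : R := log_ratio q - psum_lim q.
have Db q : 0 < q -> `|D q| <= q^-1.
  move=> q0; rewrite /D ler_norml.
  have := psum_lim_ge q 0 q0; have := psum_lim_lt q 0 q0; rewrite psum0 expr1.
  have := log_ratio_le0 q q0; have := log_ratio_ge q q0.
  by move=> *; apply/andP; split; lra.
have DS q : 0 < q -> `|D (q + 1)| = `|D q|.
  move=> q0; rewrite -[RHS]normrN /D; congr (`|_|).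
  have := log_ratioD q q0; have := psum_limD q q0; lra.
have Dn n : `|D (p + n%:R)| = `|D p|.
  elim: n => [|n IH]; first by rewrite addr0.
  by rewrite -natr1 addrA DS// ltr_wpDr.
apply/eqP; rewrite -subr_eq0 -normr_eq0 -/(D p); apply/eqP/le_anti.
rewrite normr_ge0 andbT; apply/ler_addgt0Pr => e e0; rewrite add0r.
pose n := (Num.truncn e^-1).+1.
have ne : e^-1 <= p + n%:R by rewrite (le_trans (ltW (truncnS_gt _)))// lerDr ltW.
rewrite -(Dn n); apply: le_trans (Db _ _) _; first by rewrite addr_gt0.
by rewrite -[leRHS]invrK lef_pV2 ?posrE ?invr_gt0 ?addr_gt0.
Qed.

Lemma gamma_ratioE {R : realType} (p : R) : 0 < p ->
  gamma_ratio p = expR (psum_lim p) * Num.sqrt (p / 2).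
Proof.
move=> p0; rewrite -log_ratio_psum_lim// sqrt_expR ?divr_gt0// -expRD subrK lnK//.
by rewrite posrE gamma_ratio_gt0.
Qed.

Lemma wallisE {R : realType} (x : R) : wallis x = gamma_ratio (2 * x + 1).
Proof. by rewrite /wallis /gamma_ratio; congr (Gamma _ / Gamma _); field. Qed.

(** * Errors of the bounds *)

Definition psum_err {R : realType} (p : R) (k : nat) : R := psum p k - psum_lim p.

Lemma psum_err_gt0 {R : realType} (p : R) (k : nat) : 0 < p -> 0 < psum_err p k.
Proof. by move=> p0; rewrite subr_gt0 psum_lim_lt. Qed.

Lemma psum_err_le {R : realType} (p : R) (k : nat) : 0 < p ->
  psum_err p k <= 2 ^- k.+1 / p.
Proof. by move=> p0; rewrite lerBlDr -lerBlDl psum_lim_ge. Qed.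

Lemma psum_err_lt {R : realType} (p : R) (k : nat) : 0 < p ->
  psum_err p k.+1 < psum_err p k.
Proof. by move=> p0; rewrite ltrD2r psumS_lt. Qed.

Lemma double_gt0 {R : realType} (x : R) : - 2^-1 < x -> 0 < 2 * x + 1.
Proof. lra. Qed.

Lemma calU_infty {R : realType} (x : R) : - 2^-1 < x -> calU None x = wallis x.
Proof. by move=> /double_gt0 p0; rewrite wallisE gamma_ratioE. Qed.

Lemma calU_fin {R : realType} (x : R) (k : nat) : - 2^-1 < x ->
  calU (Some k) x = wallis x * expR (psum_err (2 * x + 1) k).
Proof.
move=> /double_gt0 p0; rewrite wallisE gamma_ratioE// mulrAC -expRD [psum_lim _ + _]addrC subrK.
by [].
Qed.

(** The lower bound with k = oo equals the upper one: this is [psum_limD]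
    exponentiated. *)
Lemma expR_psum_limV {R : realType} (p : R) : 0 < p ->
  Num.sqrt (p / (p + 1)) * (1 / expR (psum_lim (p + 1))) = expR (psum_lim p).
Proof.
move=> p0; have p1 : 0 < p + 1 by rewrite addr_gt0.
rewrite sqrt_expR ?divr_gt0// div1r -expRN -expRD ln_div ?posrE//.
by rewrite -psum_limD// addrK.
Qed.

Lemma calL_infty {R : realType} (x : R) : - 2^-1 < x -> calL None x = wallis x.
Proof.
by move=> /double_gt0 p0; rewrite wallisE gamma_ratioE// -expR_psum_limV.
Qed.

Lemma calL_fin {R : realType} (x : R) (k : nat) : - 2^-1 < x ->
  calL (Some k) x = wallis x * expR (- psum_err (2 * x + 1 + 1) k).
Proof.
move=> /double_gt0 p0; rewrite wallisE gamma_ratioE// -expR_psum_limV//.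
rewrite /calL /Lbd /Ubd -/(psum _ _) /psum_err opprB expRB.
by field; rewrite !gt_eqF ?expR_gt0.
Qed.

Lemma wallis_gt0 {R : realType} (x : R) : - 2^-1 < x -> 0 < wallis x.
Proof. by move=> /double_gt0 p0; rewrite wallisE gamma_ratio_gt0. Qed.

Lemma wallis_le_sqrt {R : realType} (x : R) : - 2^-1 < x ->
  wallis x <= Num.sqrt (2 * x + 1).
Proof.
move=> /double_gt0; set p := 2 * x + 1 => p0; rewrite wallisE gamma_ratioE//.
apply: (@le_trans _ _ (1 * Num.sqrt (p / 2))).
  rewrite ler_wpM2r ?sqrtr_ge0// expR_le1 ltW//.
  by rewrite -(psum0 p) psum_lim_lt.
by rewrite mul1r ler_sqrt ?ltW//; lra.
Qed.

(** The relative error is exp(e) - 1 <= e exp(e) with e = err_k(p) at most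
    2^(-k)/p and at most 1/p. *)
Lemma relU_bound {R : realType} (x : R) (k : nat) : - 2^-1 < x ->
  0 <= (calU (Some k) x - wallis x) / wallis x
    <= expR (2 * x + 1)^-1 / (2 * x + 1) * 2^-1 ^+ k.
Proof.
move=> hx; have w0 := wallis_gt0 x hx; rewrite calU_fin//.
have p0 := double_gt0 x hx; set p := 2 * x + 1.
set e := psum_err p k; have e0 : 0 < e := psum_err_gt0 p k p0.
have -> : (wallis x * expR e - wallis x) / wallis x = expR e - 1.
  by field; rewrite gt_eqF.
have q1 : 2^-1 ^+ k <= 1 :> R by rewrite exprn_ile1// invf_le1// ler1n.
have eq : e <= p^-1 * 2^-1 ^+ k.
  apply: le_trans (psum_err_le p k p0) _.
  rewrite mulrC ler_wpM2l ?invr_ge0 ?(ltW p0)// exprVn lef_pV2 ?posrE ?exprn_gt0//.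
  by rewrite ler_eXn2l// ltr1n.
have ep : e <= p^-1 by apply: le_trans eq _; rewrite ler_piMr ?invr_ge0 ?(ltW p0).
apply/andP; split; first by rewrite subr_ge0 ltW// expR_gt1.
(* 1 - e <= exp(-e), multiplied by exp(e) *)
have h : expR e - 1 <= e * expR e.
  have := expR_ge1Dx (- e).
  rewrite expRN -(ler_pM2r (expR_gt0 e)) mulVf ?gt_eqF ?expR_gt0//.
  lra.
apply: le_trans h _; rewrite -mulrA mulrC ler_pM ?expR_ge0 ?ler_expR// ltW//.
Qed.

(** The relative error 1 - exp(-e) is at most e; the factor exp(1/p) >= 1 puts the
    bound in the form of [relU_bound], so that both errors are treated alike. *)
Lemma relL_bound {R : realType} (x : R) (k : nat) : - 2^-1 < x ->
  0 <= (wallis x - calL (Some k) x) / wallis x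
    <= expR (2 * x + 1)^-1 / (2 * x + 1) * 2^-1 ^+ k.
Proof.
move=> hx; have w0 := wallis_gt0 x hx; rewrite calL_fin//.
have p0 := double_gt0 x hx; set p := 2 * x + 1.
have p1 : 0 < p + 1 by rewrite addr_gt0.
set e := psum_err (p + 1) k; have e0 : 0 < e := psum_err_gt0 _ k p1.
have -> : (wallis x - wallis x * expR (- e)) / wallis x = 1 - expR (- e).
  by field; rewrite gt_eqF.
have eq : e <= p^-1 * 2^-1 ^+ k.
  apply: le_trans (psum_err_le _ k p1) _.
  rewrite mulrC ler_pM ?invr_ge0 ?exprn_ge0 ?(ltW p1)//.
    by rewrite lef_pV2 ?posrE// lerDl.
  by rewrite exprVn lef_pV2 ?posrE ?exprn_gt0// ler_eXn2l// ltr1n.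
apply/andP; split; first by rewrite subr_ge0 expR_le1 oppr_le0 ltW.
apply: (@le_trans _ _ e); first by have := expR_ge1Dx (- e); lra.
apply: le_trans eq _; rewrite ler_wpM2r ?exprn_ge0// ler_peMl ?invr_ge0 ?(ltW p0)//.
by rewrite ltW// expR_gt1 invr_gt0.
Qed.

Lemma cvg0_of_inv_sqrt_bound {R : realType} (f : R -> R) (C : R) : 0 < C ->
  (forall x, 1 <= x -> 0 <= f x <= C / Num.sqrt x) ->
  f x @[x --> +oo] --> (0 : R).
Proof.
move=> C0 fC; apply/cvgrPdist_le => e e0; near=> x.
have x1 : 1 <= x by near: x; exact: nbhs_pinfty_ge.
have x0 : 0 < x := lt_le_trans ltr01 x1.
have /andP[f0 fle] := fC x x1.
rewrite sub0r normrN ger0_norm//; apply: le_trans fle _.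
rewrite ler_pdivrMr ?sqrtr_gt0// -ler_pdivrMl// mulrC.
rewrite -(ger0_norm (ltW (divr_gt0 C0 e0))) -sqrtr_sqr ler_sqrt; last exact: ltW.
near: x; apply: nbhs_pinfty_ge; exact: num_real.
Unshelve. all: by end_near. Qed.

(** For x >= 1 the relative error is O(1/p) and W is at most sqrt p, so the
    relative and the absolute error are both O(1 / sqrt x). *)
Lemma error_cvg0 {R : realType} (f : R -> R) (c : R) : 0 <= c <= 1 ->
  (forall x, - 2^-1 < x ->
     0 <= f x / wallis x <= expR (2 * x + 1)^-1 / (2 * x + 1) * c) ->
  f x / wallis x @[x --> +oo] --> (0 : R) /\ f x @[x --> +oo] --> (0 : R).
Proof.
move=> /andP[c0 c1] fb.
have h x : 1 <= x -> 0 <= f x / wallis x <= expR 1 / (2 * x + 1).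
  move=> x1; have hx : - 2^-1 < x by lra.
  have /andP[-> /le_trans] := fb x hx; apply.
  have p0 := double_gt0 x hx.
  apply: (@le_trans _ _ (expR (2 * x + 1)^-1 / (2 * x + 1))).
    by rewrite ler_piMr// divr_ge0 ?expR_ge0 ?(ltW p0).
  rewrite ler_wpM2r ?invr_ge0 ?(ltW p0)// ler_expR invf_le1//; lra.
have sq (x : R) : 1 <= x ->
    (2 * x + 1)^-1 <= (Num.sqrt (2 * x + 1))^-1 <= (Num.sqrt x)^-1.
  move=> x1; have p0 : 0 < 2 * x + 1 by lra.
  have x0 : 0 < x by lra.
  rewrite !lef_pV2 ?posrE ?sqrtr_gt0//; apply/andP; split; last first.
    by rewrite ler_sqrt ?(ltW p0)//; lra.
  rewrite -[leRHS]ger0_norm ?(ltW p0)// -sqrtr_sqr ler_sqrt ?sqr_ge0//.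
  by rewrite expr2 ler_peMl ?(ltW p0)//; lra.
split; apply: (@cvg0_of_inv_sqrt_bound _ _ (expR 1)); rewrite ?expR_gt0// => x x1;
  have /andP[s1 s2] := sq x x1; have /andP[h1 h2] := h x x1.
  rewrite h1/=; apply: le_trans h2 _; rewrite ler_wpM2l ?expR_ge0//.
  exact: le_trans s1 s2.
have hx : - 2^-1 < x by lra.
have w0 := wallis_gt0 x hx; have p0 := double_gt0 x hx.
rewrite -(divfK (lt0r_neq0 w0) (f x)) mulr_ge0 ?(ltW w0)//=.
apply: (@le_trans _ _ (expR 1 / (2 * x + 1) * Num.sqrt (2 * x + 1))).
  by rewrite ler_pM ?(ltW w0)// wallis_le_sqrt.
rewrite -mulrA ler_wpM2l ?expR_ge0//; apply: le_trans s2.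
rewrite -{1}(sqr_sqrtr (ltW p0)) expr2 invfM mulfVK//.
by rewrite gt_eqF// sqrtr_gt0.
Qed.

Theorem corollary1p2 (R : realType) :
  (forall (x : R) (k : nat), - 2^-1 < x ->
    calL (Some k) x < calL (Some k.+1) x /\
    calL (Some k.+1) x < calL None x /\
    calL None x = wallis x /\
    wallis x = calU None x /\
    calU None x < calU (Some k.+1) x /\
    calU (Some k.+1) x < calU (Some k) x) /\
  (forall x0 : R, - 2^-1 < x0 ->
    exists C q : R, 0 < C /\ 0 < q /\ q < 1 /\
      forall (x : R) (k : nat), x0 <= x ->
        (calU (Some k) x - wallis x) / wallis x <= C * q ^+ k /\
        (wallis x - calL (Some k) x) / wallis x <= C * q ^+ k) /\
  (forall k : nat,
    (calU (Some k) x - wallis x) / wallis x @[x --> +oo] --> (0 : R) /\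
    (wallis x - calL (Some k) x) / wallis x @[x --> +oo] --> (0 : R)) /\
  (forall k : nat,
    calU (Some k) x - wallis x @[x --> +oo] --> (0 : R) /\
    wallis x - calL (Some k) x @[x --> +oo] --> (0 : R)).
Proof.
have q01 k : 0 <= (2^-1 : R) ^+ k <= 1.
  by rewrite exprn_ge0//= exprn_ile1// invf_le1// ler1n.
have limU k := error_cvg0 _ _ (q01 k) (fun x => relU_bound x k).
have limL k := error_cvg0 _ _ (q01 k) (fun x => relL_bound x k).
split; last split; last by split=> k; have [] := limU k; have [] := limL k.
- move=> x k hx; have w0 := wallis_gt0 x hx; have p0 := double_gt0 x hx.
  have p1 : 0 < 2 * x + 1 + 1 by rewrite addr_gt0.
  rewrite calL_infty// calU_infty// !calL_fin// !calU_fin//.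
  rewrite !ltr_pM2l// !ltr_expR ltrN2 !psum_err_lt// gtr_pMr// expR_lt1.
  by rewrite oppr_lt0 psum_err_gt0// ltr_pMr// expR_gt1 psum_err_gt0.
- move=> x0 hx0; have p0 := double_gt0 x0 hx0.
  exists (expR (2 * x0 + 1)^-1 / (2 * x0 + 1)), 2^-1.
  split; first by rewrite divr_gt0 ?expR_gt0.
  split; first by rewrite invr_gt0.
  split; first by rewrite invf_lt1// ltr1n.
  move=> x k hx; have hx' := lt_le_trans hx0 hx; have p := double_gt0 x hx'.
  have /andP[_ hU] := relU_bound x k hx'; have /andP[_ hL] := relL_bound x k hx'.
  have inv_le : (2 * x + 1)^-1 <= (2 * x0 + 1)^-1 by rewrite lef_pV2 ?posrE//; lra.
  have C_le : expR (2 * x + 1)^-1 / (2 * x + 1) * 2^-1 ^+ k <=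
              expR (2 * x0 + 1)^-1 / (2 * x0 + 1) * 2^-1 ^+ k.
    by rewrite ler_wpM2r ?exprn_ge0// ler_pM ?expR_ge0 ?ler_expR// invr_ge0 ltW.
  by split; apply: le_trans C_le.
Qed.
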